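(* Let $A\in\mathbb{R}^{m\times n}$, $b\in\mathbb{R}^m$ with $Ax=b$ consistent, let $B\in\mathbb{R}^{n\times n}$, $G\in\mathbb{R}^{p\times p}$ be symmetric positive definite and $S\in\mathbb{R}^{m\times p}$. As $\rho\to\infty$ the Penalty Sketching (PS) and Augmented Lagrangian Sketching (ALS) methods both become the Sketch & Project (SP) method; that is, for all $x_k\in\mathbb{R}^n$ and $z_k\in\mathbb{R}^p$, $$\lim_{\rho\to\infty}x_{k+1}^{\mathrm{PS}}(\rho)=\lim_{\rho\to\infty}x_{k+1}^{\mathrm{ALS}}(\rho)=x_k-B^{-1}A^\top S\,(S^\top AB^{-1}A^\top S)^\dagger S^\top(Ax_k-b).$$
   Context: $M^\dagger$ is the Moore–Penrose pseudoinverse. For $\rho>0$ let $H_\rho=\big(\tfrac1\rho G+S^\top AB^{-1}A^\top S\big)^{-1}$. One step of the PS method from $x_k$ with sketch matrix $S$ and penalty $\rho$ is $$x_{k+1}^{\mathrm{PS}}(\rho)=x_k-B^{-1}A^\top SH_\rho S^\top(Ax_k-b).$$ One step of the ALS method from $(x_k,z_k)$ is $$z_{k+1}=H_\rho\Big(S^\top Ax_k-S^\top b+\tfrac1\rho Gz_k\Big),\qquad x_{k+1}^{\mathrm{ALS}}(\rho)=x_k-B^{-1}A^\top Sz_{k+1}.$$ One step of the SP method from $x_k$ is $x_{k+1}=\arg\min_x\{\tfrac12\|x-x_k\|_B^2: S^\top Ax=S^\top b\}=x_k-B^{-1}A^\top S(S^\top AB^{-1}A^\top S)^\dagger S^\top(Ax_k-b)$,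 where $\|x\|_B^2=x^\top Bx$. *)

(* Defs.v *)
From HB Require Import structures.
From mathcomp Require Import all_boot all_order all_algebra.
From mathcomp Require Import all_classical all_reals all_analysis.
Import Order.TTheory GRing.Theory Num.Theory.

Set Implicit Arguments.
Unset Strict Implicit.
Unset Printing Implicit Defensive.

Local Open Scope classical_set_scope.
Local Open Scope ring_scope.

Definition sqnormB (R : realType) (n : nat) (B : 'M[R]_n) (x : 'cV[R]_n) : R :=
  (x^T *m B *m x) 0 0.

Definition spd (R : realType) (n : nat) (B : 'M[R]_n) : Prop :=
  B^T = B /\ forall x : 'cV[R]_n, x != 0 -> 0 < sqnormB B x.

(* The four Penrose conditions. *)
Definition is_pinv (R : realType) (m n : nat) (M : 'M[R]_(m, n))
    (X : 'M[R]_(n, m)) : Prop :=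
  [/\ M *m X *m M = M, X *m M *m X = X,
      (M *m X)^T = M *m X & (X *m M)^T = X *m M].

(* The default value 0 is never used: see pinvP and pinv_uniq. *)
Definition pinv (R : realType) (m n : nat) (M : 'M[R]_(m, n)) : 'M[R]_(n, m) :=
  xget 0 [set X | is_pinv M X].

Section Steps.
Variables (R : realType) (m n p : nat).
Variables (A : 'M[R]_(m, n)) (b : 'cV[R]_m) (B : 'M[R]_n) (G : 'M[R]_p).
Variables (S : 'M[R]_(m, p)).

Definition sketch_gram : 'M[R]_p := S^T *m A *m invmx B *m A^T *m S.

Definition Hmx (rho : R) : 'M[R]_p := invmx (rho^-1 *: G + sketch_gram).

Definition ps_step (rho : R) (x : 'cV[R]_n) : 'cV[R]_n :=
  x - invmx B *m A^T *m S *m Hmx rho *m S^T *m (A *m x - b).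

Definition als_dual_step (rho : R) (x : 'cV[R]_n) (z : 'cV[R]_p) : 'cV[R]_p :=
  Hmx rho *m (S^T *m A *m x - S^T *m b + rho^-1 *: (G *m z)).

Definition als_step (rho : R) (x : 'cV[R]_n) (z : 'cV[R]_p) : 'cV[R]_n :=
  x - invmx B *m A^T *m S *m als_dual_step rho x z.

(* Closed form of the projection step; sp_step_argmin and sp_step_uniq
   identify it with the unique minimiser of the sketched problem. *)
Definition sp_step (x : 'cV[R]_n) : 'cV[R]_n :=
  x - invmx B *m A^T *m S *m pinv sketch_gram *m S^T *m (A *m x - b).

Definition is_sp_argmin (x x' : 'cV[R]_n) : Prop :=
  S^T *m A *m x' = S^T *m b /\
  forall y : 'cV[R]_n, S^T *m A *m y = S^T *m b ->
    2^-1 * sqnormB B (x' - x) <= 2^-1 * sqnormB B (y - x).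

End Steps.

Section PinvTheory.
Variable R : realType.

Lemma trmx_mul_self_eq0 n q (X : 'M[R]_(n, q)) : X^T *m X = 0 -> X = 0.
Proof.
move=> X0; apply/matrixP => i j; rewrite [RHS]mxE.
have /matrixP/(_ j j) := X0; rewrite !mxE => /eqP.
rewrite psumr_eq0; last by move=> k _; rewrite mxE -expr2 sqr_ge0.
by move=> /allP/(_ i); rewrite mem_index_enum mxE -expr2 sqrf_eq0 => /(_ isT)/eqP.
Qed.

Lemma gram_unit n r (F : 'M[R]_(r, n)) : row_free F -> F *m F^T \in unitmx.
Proof.
move=> Ff; rewrite -row_free_unit -kermx_eq0; apply/eqP.
set K := kermx _.
have K0 : K *m (F *m F^T) = 0 by rewrite mulmx_ker.
have : (K *m F)^T = 0.
  by apply: trmx_mul_self_eq0; rewrite trmxK trmx_mul mulmxA -(mulmxA K) K0 mul0mx.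
move=> /(congr1 trmx); rewrite trmxK trmx0 => KF0.
by apply: (row_free_inj Ff); rewrite mul0mx.
Qed.

Lemma pinv_exists m n (M : 'M[R]_(m, n)) : exists X, is_pinv M X.
Proof.
have [r [C [F [FU CU ->]]]] : exists r, exists C : 'M[R]_(m, r),
    exists F : 'M[R]_(r, n),
    [/\ F *m F^T \in unitmx, C^T *m C \in unitmx & M = C *m F].
  exists (\rank M), (col_base M), (row_base M); split.
  - exact/gram_unit/row_base_free.
  - rewrite -{2}[col_base M]trmxK; apply: gram_unit.
    by rewrite /row_free mxrank_tr; apply: col_base_full.
  - by rewrite mulmx_base.
have sF : (invmx (F *m F^T))^T = invmx (F *m F^T).
  by rewrite trmx_inv trmx_mul trmxK.
have sC : (invmx (C^T *m C))^T = invmx (C^T *m C).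
  by rewrite trmx_inv trmx_mul trmxK.
have FV := mulmxV FU; have CV := mulVmx CU.
set U := invmx (F *m F^T) in sF FV; set V := invmx (C^T *m C) in sC CV.
pose X := F^T *m U *m V *m C^T.
have MX : C *m F *m X = C *m V *m C^T.
  by rewrite /X !mulmxA -(mulmxA C F) -(mulmxA C _ U) FV mulmx1.
have XM : X *m (C *m F) = F^T *m U *m F.
  by rewrite /X !mulmxA -(mulmxA _ C^T C) -(mulmxA _ V) CV mulmx1.
exists X; split.
- by rewrite MX !mulmxA -(mulmxA _ C^T C) -(mulmxA _ V) CV mulmx1.
- by rewrite XM /X !mulmxA -(mulmxA _ F F^T) -(mulmxA _ (F *m F^T) U) FV mulmx1.
- by rewrite MX !trmx_mul trmxK sC mulmxA.
- by rewrite XM !trmx_mul trmxK sF mulmxA.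
Qed.

Lemma pinvP m n (M : 'M[R]_(m, n)) : is_pinv M (pinv M).
Proof. exact: (xgetPex 0 (pinv_exists M)). Qed.

Lemma pinv_uniq m n (M : 'M[R]_(m, n)) X : is_pinv M X -> X = pinv M.
Proof.
have [] := pinvP M; set Y := pinv M => a2 b2 c2 d2 [a1 b1 c1 d1].
have e1 : M *m X = M *m Y.
  rewrite -c1 -{1}a2 -(mulmxA (M *m Y)) trmx_mul c1 c2.
  by rewrite mulmxA a1.
have e2 : X *m M = Y *m M.
  rewrite -d1 -{1}a2 -!mulmxA mulmxA trmx_mul d1 d2.
  by rewrite -mulmxA (mulmxA M) a1.
by rewrite -b1 -mulmxA e1 mulmxA e2 b2.
Qed.

Lemma spd_unit n (B : 'M[R]_n) : spd B -> B \in unitmx.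
Proof.
case=> _ Bpos; rewrite -row_free_unit -kermx_eq0; apply/eqP/row_matrixP => i.
rewrite row0; apply/eqP/negPn/negP => v0.
have : row i (kermx B) *m B = 0 by rewrite -row_mul mulmx_ker row0.
set v := row i _ in v0 * => vB.
have := Bpos v^T; rewrite /sqnormB trmxK vB mul0mx mxE ltxx => H.
have : v^T != 0 by apply: contra_neq v0 => /(congr1 trmx); rewrite trmxK trmx0.
by move/H.
Qed.

Lemma spd_inv n (B : 'M[R]_n) : spd B -> spd (invmx B).
Proof.
move=> hB; have BU := spd_unit hB; case: hB => sB Bpos.
split=> [|x x0]; first by rewrite trmx_inv sB.
have := Bpos (invmx B *m x); rewrite /sqnormB trmx_mul trmx_inv sB.
rewrite -!mulmxA (mulmxA B) mulmxV // mul1mx; apply.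
by apply: contra_neq x0 => h; rewrite -[x]mul1mx -(mulmxV BU) -mulmxA h mulmx0.
Qed.

Lemma sqnormB_ge0 n (B : 'M[R]_n) x : spd B -> 0 <= sqnormB B x.
Proof.
case=> _ Bpos; have [->|x0] := eqVneq x 0; last exact/ltW/Bpos.
by rewrite /sqnormB mulmx0 mxE.
Qed.

Lemma spd_mul_eq0 n q (B : 'M[R]_n) (X : 'M[R]_(n, q)) :
  spd B -> X^T *m B *m X = 0 -> X = 0.
Proof.
move=> [_ Bpos] X0; apply: trmx_inj; apply/row_matrixP => j.
rewrite trmx0 row0 -tr_col colE; apply/eqP/negPn/negP => v0.
set e : 'cV[R]_q := delta_mx j 0 in v0 *.
have := Bpos (X *m e).
have -> : sqnormB B (X *m e) = (e^T *m (X^T *m B *m X) *m e) 0 0.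
  by rewrite /sqnormB trmx_mul !mulmxA.
rewrite X0 mulmx0 mul0mx mxE ltxx => H.
have : X *m e != 0 by apply: contra_neq v0 => ->; rewrite trmx0.
by move/H.
Qed.

End PinvTheory.

Section SketchProject.
Variables (R : realType) (m n p : nat).
Variables (A : 'M[R]_(m, n)) (b : 'cV[R]_m) (B : 'M[R]_n).
Variables (S : 'M[R]_(m, p)).
Hypothesis consistent : exists x : 'cV[R]_n, A *m x = b.
Hypothesis B_spd : spd B.

Let M := sketch_gram A B S.
Let W := S^T *m A.

Let WT : W^T = A^T *m S. Proof. by rewrite trmx_mul trmxK. Qed.

Let ME : M = W *m invmx B *m W^T.
Proof. by rewrite WT /M /sketch_gram /W !mulmxA. Qed.

Let MPW : M *m pinv M *m W = W.
Proof.
have [a _ c _] := pinvP M.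
apply/eqP; rewrite -subr_eq0; apply/eqP; set N := _ - W.
have NE : N = (M *m pinv M - 1%:M) *m W by rewrite mulmxBl mul1mx.
apply: trmx_inj; rewrite trmx0; apply: (spd_mul_eq0 (spd_inv B_spd)).
set Q := _ - _ in NE; rewrite trmxK.
have -> : N *m invmx B *m N^T = Q *m M *m Q^T.
  by rewrite NE ME trmx_mul !mulmxA.
by rewrite mulmxBl a mul1mx subrr mul0mx.
Qed.

Let sp_feasible (x : 'cV[R]_n) : W *m sp_step A b B S x = S^T *m b.
Proof.
case: consistent => u <-; rewrite /sp_step -mulmxBr (mulmxBr W).
have -> : W *m (invmx B *m A^T *m S *m pinv M *m S^T *m (A *m (x - u)))
          = M *m pinv M *m W *m (x - u) by rewrite ME WT /W !mulmxA.
by rewrite MPW mulmxBr opprB addrC subrK /W mulmxA.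
Qed.

Let sp_split (x y : 'cV[R]_n) : W *m y = S^T *m b ->
  sqnormB B (y - x) = sqnormB B (sp_step A b B S x - x)
                      + sqnormB B (y - sp_step A b B S x).
Proof.
move=> yf; set x' := sp_step _ _ _ _ _; set d := x' - x; set e := y - x'.
have We : W *m e = 0 by rewrite mulmxBr yf sp_feasible subrr.
have Bd : B *m d = - (W^T *m (pinv M *m S^T *m (A *m x - b))).
  rewrite /d /x' /sp_step addrC addKr mulmxN WT !mulmxA mulmxV ?spd_unit //.
  by rewrite mul1mx.
have ed0 : e^T *m B *m d = 0.
  by rewrite -mulmxA Bd mulmxN (mulmxA e^T) -trmx_mul We trmx0 mul0mx oppr0.
have de0 : d^T *m B *m e = 0.
  by case: B_spd => sB _; apply: trmx_inj; rewrite !trmx_mul trmxK sB mulmxA ed0 !trmx0.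
have -> : y - x = d + e by rewrite /d /e [RHS]addrC addrA subrK.
move: d e ed0 de0 {We Bd} => d e ed0 de0.
rewrite /sqnormB [(d + e)^T]raddfD /= !mulmxDl !mulmxDr ed0 de0 addr0 add0r.
by rewrite mxE.
Qed.

Lemma sp_step_argmin (x : 'cV[R]_n) :
  is_sp_argmin A b B S x (sp_step A b B S x).
Proof.
split=> [|y yf]; first exact: sp_feasible.
rewrite (sp_split x yf) ler_pM2l ?invr_gt0 // lerDl.
exact: sqnormB_ge0.
Qed.

Lemma sp_step_uniq (x x' : 'cV[R]_n) :
  is_sp_argmin A b B S x x' -> x' = sp_step A b B S x.
Proof.
move=> [x'f /(_ _ (sp_feasible x))].
rewrite (sp_split x x'f) ler_pM2l ?invr_gt0 // gerDl.
case: B_spd => _ Bpos h; apply/eqP; rewrite -subr_eq0.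
by apply/negPn/negP => /Bpos; rewrite ltNge h.
Qed.

End SketchProject.

(* Main.v *)
(* The sketched residual r lies in the range of the Gram matrix
   M = S^T A B^-1 A^T S, so r = M y with y = M^+ r.  Hence, with K = B^-1 A^T S,
   the ALS step differs from the SP step by K w, where
   (G / rho + M) w = G (y - z) / rho.  Testing this equation against w bounds
   the squared B-norm of K w by a multiple of 1 / rho.  The PS step is the ALS
   step from z = 0. *)

Require Import Defs.
From HB Require Import structures.
From mathcomp Require Import all_boot all_order all_algebra.
From mathcomp Require Import all_classical all_reals all_analysis.
From mathcomp Require Import ring lra.
Import Order.TTheory GRing.Theory Num.Theory.
Import numFieldNormedType.Exports.

Set Implicit Arguments.
Unset Strict Implicit.
Unset Printing Implicit Defensive.

Local Open Scope classical_set_scope.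
Local Open Scope ring_scope.

Section QuadraticForms.
Variable R : realType.

Lemma sqnormB_comb n (B : 'M[R]_n) (a c : R) (x y : 'cV[R]_n) : B^T = B ->
  sqnormB B (a *: x + c *: y) =
  a ^+ 2 * sqnormB B x + (a * c * (x^T *m B *m y) 0 0) *+ 2
  + c ^+ 2 * sqnormB B y.
Proof.
move=> sB; have yx : y^T *m B *m x = x^T *m B *m y.
  have -> : x^T *m B *m y = (y^T *m B *m x)^T.
    by rewrite !trmx_mul trmxK sB mulmxA.
  by apply/matrixP => i j; rewrite !ord1 [RHS]mxE.
rewrite /sqnormB [(a *: x + _)^T]linearD !linearZ /= !mulmxDl !mulmxDr.
rewrite -!scalemxAl -!scalemxAr.
by rewrite yx !mxE; ring.
Qed.

Lemma sqnormBD n (a : R) (B C : 'M[R]_n) x :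
  sqnormB (a *: B + C) x = a * sqnormB B x + sqnormB C x.
Proof. by rewrite /sqnormB mulmxDr mulmxDl -scalemxAr -scalemxAl !mxE. Qed.

Lemma sqnormB_congr n p (B : 'M[R]_n) (K : 'M[R]_(n, p)) w :
  sqnormB (K^T *m B *m K) w = sqnormB B (K *m w).
Proof. by rewrite /sqnormB trmx_mul !mulmxA. Qed.

Lemma spd_cauchy_schwarz n (B : 'M[R]_n) (x y : 'cV[R]_n) : spd B ->
  (x^T *m B *m y) 0 0 ^+ 2 <= sqnormB B x * sqnormB B y.
Proof.
move=> hB; have [sB Bpos] := hB.
have [->|/Bpos x0] := eqVneq x 0.
  by rewrite /sqnormB trmx0 !mul0mx mxE mul0r expr0n.
(* This vector is the component of [y] that is B-orthogonal to [x], multiplied by [sqnormB B x] to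
   avoid a division; its squared B-norm is [sqnormB B x] times the difference to be shown
   nonnegative. *)
have := sqnormB_ge0 (- (x^T *m B *m y) 0 0 *: x + sqnormB B x *: y) hB.
rewrite sqnormB_comb //; set c := (x^T *m B *m y) 0 0 => h.
rewrite -subr_ge0 -(pmulr_rge0 _ x0).
by congr (0 <= _): h; ring.
Qed.

(** Cauchy-Schwarz for [invmx B *m e] and [d], with [e] the i-th unit vector: their B-product is the
    i-th coordinate of [d], and the first has squared B-norm [invmx B i i]. *)
Lemma sqr_coord_le n (B : 'M[R]_n) (d : 'cV[R]_n) i : spd B ->
  d i 0 ^+ 2 <= invmx B i i * sqnormB B d.
Proof.
move=> hB; have BU := spd_unit hB; have [sB _] := hB.
set e : 'cV[R]_n := delta_mx i 0.
have := spd_cauchy_schwarz (invmx B *m e) d hB.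
rewrite /sqnormB trmx_mul trmx_inv sB !mulmxKV // trmx_delta.
by rewrite -!rowE -colE !mxE.
Qed.

(** Balls of column vectors are entrywise, so the B-norm bound is passed to each coordinate;
    finitely many coordinates share one threshold for [rho]. *)
Lemma cvg_sqnormB n (B : 'M[R]_n) (f : R -> 'cV[R]_n) l (C : R) : spd B ->
  (forall rho, 0 < rho -> sqnormB B (f rho - l) <= C / rho) ->
  f rho @[rho --> +oo] --> l.
Proof.
move=> hB fC; apply/cvg_ballP => e e0.
have : \forall rho \near +oo, forall i, `|(f rho - l) i 0| < e.
  apply: filter_forall => i; near=> rho.
  have rho0 : 0 < rho by near: rho; exact: nbhs_pinfty_gt.
  rewrite -(ltr_pXn2r (n := 2)) ?nnegrE ?(ltW e0) //.
  rewrite real_normK ?num_real //.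
  apply: le_lt_trans (sqr_coord_le _ i hB) _.
  have Bi : 0 <= invmx B i i.
    have := sqnormB_ge0 (delta_mx i 0) (spd_inv hB).
    by rewrite /sqnormB trmx_delta -rowE -colE !mxE.
  apply: le_lt_trans (ler_wpM2l Bi (fC _ rho0)) _.
  rewrite mulrA ltr_pdivrMr // -ltr_pdivrMl ?exprn_gt0 //.
  by near: rho; apply: nbhs_pinfty_gt; exact: num_real.
apply: filterS => rho h; split=> // i j; rewrite ord1 -ball_normE /= distrC.
by have := h i; rewrite !mxE.
Unshelve. all: by end_near.
Qed.

(* Pairing the equation with w and completing the square in the G-form. *)
Lemma penalty_energy_bound n p (B : 'M[R]_n) (G : 'M[R]_p) (K : 'M[R]_(n, p))
    (a : R) (v w : 'cV[R]_p) : spd G -> 0 <= a ->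
  (a *: G + K^T *m B *m K) *m w = a *: (G *m v) ->
  sqnormB B (K *m w) <= a / 4 * sqnormB G v.
Proof.
move=> hG a0 eqw; have [sG _] := hG.
have : sqnormB (a *: G + K^T *m B *m K) w = a * (w^T *m G *m v) 0 0.
  by rewrite /sqnormB -mulmxA eqw -scalemxAr mulmxA mxE.
rewrite sqnormBD sqnormB_congr => E.
(* Expanding this square bounds w^T G v - w^T G w by a quarter of [sqnormB G v], which is where the
   constant 1/4 comes from. *)
have := sqnormB_ge0 (2 *: w + (-1) *: v) hG.
rewrite sqnormB_comb // => /(mulr_ge0 a0) h.
move: E h; set q := sqnormB B _; set g := sqnormB G w; set h := sqnormB G v.
by set c := (_ *m v) 0 0 => E h0; nra.
Qed.

(** Makes [Hmx] a genuine inverse at every positive [rho]: the Gram part is only semidefinite when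
    [K] has a kernel, and strictness comes from [G]. *)
Lemma spd_penalty n p (B : 'M[R]_n) (G : 'M[R]_p) (K : 'M[R]_(n, p)) (a : R) :
  spd B -> spd G -> 0 < a -> spd (a *: G + K^T *m B *m K).
Proof.
move=> hB [sG Gpos] a0; have [sB _] := hB; split.
  by rewrite linearD linearZ /= !trmx_mul trmxK sG sB mulmxA.
move=> x /Gpos Gx; rewrite sqnormBD sqnormB_congr.
by rewrite ltr_wpDr ?sqnormB_ge0 // mulr_gt0.
Qed.

End QuadraticForms.

Section Steps.
Variables (R : realType) (m n p : nat).
Variables (A : 'M[R]_(m, n)) (b : 'cV[R]_m) (B : 'M[R]_n) (G : 'M[R]_p).
Variables (S : 'M[R]_(m, p)).

Lemma sketch_gramE : spd B -> sketch_gram A B S =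
  (invmx B *m A^T *m S)^T *m B *m (invmx B *m A^T *m S).
Proof.
move=> hB; have [sB _] := hB; have BU := spd_unit hB.
rewrite /sketch_gram !trmx_mul trmxK trmx_inv sB !mulmxA.
by rewrite -(mulmxA _ (invmx B) B) mulVmx // mulmx1.
Qed.

(* Unqualified, [pinv] is the partial inverse of a function. *)
Lemma pinv_sketch_residual (x : 'cV[R]_n) :
  (exists u : 'cV[R]_n, A *m u = b) -> spd B ->
  sketch_gram A B S *m (Defs.pinv (sketch_gram A B S) *m (S^T *m (A *m x - b)))
  = S^T *m (A *m x - b).
Proof.
move=> hc hB; have [feas _] := sp_step_argmin S hc hB x.
(* Feasibility of the SP step, where consistency enters, writes the residual as [S^T *m A] applied
   to the SP displacement, and the closed form of that displacement supplies the pseudoinverse. *)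
apply/esym; transitivity (S^T *m A *m (x - sp_step A b B S x)).
  by rewrite mulmxBr mulmxA [RHS]mulmxBr feas.
by rewrite /sp_step subKr /sketch_gram !mulmxA.
Qed.

Lemma als_step0 rho x : als_step A b B G S rho x 0 = ps_step A b B G S rho x.
Proof.
rewrite /als_step /als_dual_step /ps_step mulmx0 scaler0 addr0.
by rewrite -(mulmxA S^T A) -(mulmxBr S^T) !mulmxA.
Qed.

Lemma als_step_cvg (x : 'cV[R]_n) (z : 'cV[R]_p) :
  (exists u : 'cV[R]_n, A *m u = b) -> spd B -> spd G ->
  als_step A b B G S rho x z @[rho --> +oo] --> sp_step A b B S x.
Proof.
move=> hc hB hG; pose M := sketch_gram A B S.
pose K := invmx B *m A^T *m S; pose r := S^T *m (A *m x - b).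
pose y := Defs.pinv M *m r.
have ME : M = K^T *m B *m K := sketch_gramE hB.
have My : M *m y = r := pinv_sketch_residual x hc hB.
(* The constant is the one from [penalty_energy_bound] with a = 1 / rho and v = y - z; it is
   independent of [rho]. *)
apply: (cvg_sqnormB (C := sqnormB G (y - z) / 4) hB) => rho rho0.
pose N := rho^-1 *: G + M.
have NU : N \in unitmx.
  by apply: spd_unit; rewrite /N ME; apply: spd_penalty; rewrite ?invr_gt0.
pose w := y - als_dual_step A b B G S rho x z.
have -> : als_step A b B G S rho x z - sp_step A b B S x = K *m w.
  have -> : sp_step A b B S x = x - K *m y by rewrite /sp_step /y /r !mulmxA.
  by rewrite /als_step -/K [RHS]mulmxBr opprB addrC addrA subrK.
have -> : sqnormB G (y - z) / 4 / rho = rho^-1 / 4 * sqnormB G (y - z) by ring.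
apply: penalty_energy_bound => //; first by rewrite invr_ge0 ltW.
(* Multiplying the dual step by [N] cancels [Hmx] and leaves r + G z / rho; since N y = G y / rho +
   r, the residual [r] drops out. *)
rewrite -ME -/N /w mulmxBr /als_dual_step /Hmx -/M -/N mulKVmx //.
rewrite -(mulmxA S^T A) -(mulmxBr S^T) -/r {1}/N mulmxDl My -scalemxAl addrKA.
by rewrite -scalerBr -mulmxBr.
Qed.

End Steps.

Theorem lemma2p7 (R : realType) (m n p : nat)
    (A : 'M[R]_(m, n)) (b : 'cV[R]_m) (B : 'M[R]_n) (G : 'M[R]_p)
    (S : 'M[R]_(m, p))
    (consistent : exists x : 'cV[R]_n, A *m x = b)
    (B_spd : spd B) (G_spd : spd G)
    (xk : 'cV[R]_n) (zk : 'cV[R]_p) :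
  ps_step A b B G S rho xk @[rho --> +oo] --> sp_step A b B S xk /\
  als_step A b B G S rho xk zk @[rho --> +oo] --> sp_step A b B S xk.
Proof.
split; last exact: als_step_cvg.
by under eq_fun do rewrite -als_step0; exact: als_step_cvg.
Qed.
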